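(* Let $G$ be a compact group and $X$ an almost Hausdorff $G$-space. Then the orbit space $G\setminus X$ is almost Hausdorff, too. Moreover, $X$ is a regular $G$-space.
   Context: All topological groups and the spaces $X$ on which they act are assumed to be $T_0$ (hence topological groups are Hausdorff). A $G$-space is a topological space $X$ with a continuous map $G\times X\to X$, $(g,x)\mapsto g\cdot x$, such that $g\cdot(h\cdot x)=(gh)\cdot x$ and $e\cdot x=x$. The orbit space $G\setminus X$ is the set of $G$-orbits with the quotient topology. A space is almost Hausdorff if every non-empty closed subset $A$ contains a non-empty, relatively open (in $A$) Hausdorff subset. A non-empty $G$-invariant closed subset $W$ of $X$ is $G$-irreducible if $W=A\cup B$ with $A,B$ $G$-invariant and closed implies $A=W$ or $B=W$. $W$ has a generic orbit if there is an orbit $G\cdot x$ with $W=\overline{G\cdot x}$. $X$ is quasi-regular if every $G$-irreducible subset has at least one generic orbit. A subset is locally closed if it is the intersection of a closed and an open subset. An orbit $G\cdot x$ (with relative topology) is a homogeneous space if $G/G_x\to G\cdot x$, $gG_x\mapsto g\cdot x$, is a homeomorphism, where $G_x$ is the stabilizer of $x$. A $G$-space $X$ is regular (a notion distinct from the separation axiom) if (i) $X$ is quasi-regular, (ii) every $G$-orbit of $X$ is locally closed, and (iii) every $G$-orbit is a homogeneous space. *)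

(* Defs.v *)
From HB Require Import structures.
From mathcomp Require Import all_boot.
From mathcomp Require Import all_classical.
From mathcomp Require Import topology.

Set Implicit Arguments.
Unset Strict Implicit.
Unset Printing Implicit Defensive.

Local Open Scope classical_set_scope.
Local Open Scope group_scope.
Local Open Scope quotient_scope.

HB.mixin Record isTopologicalGroup G & Topological G & Group G := {
  mulg_continuous : continuous (fun gh : G * G => gh.1 * gh.2) ;
  invg_continuous : continuous (fun g : G => g^-1) ;
}.

#[short(type="topologicalGroupType")]
HB.structure Definition TopologicalGroup :=
  {G of Topological G & Group G & isTopologicalGroup G}.

HB.mixin Record isGSpace (G : topologicalGroupType) X & Topological X := {
  gact : G -> X -> X ;
  gact_continuous : continuous (fun gx : G * X => gact gx.1 gx.2) ;
  gactM : forall (g h : G) (x : X), gact g (gact h x) = gact (g * h) x ;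
  gact1 : forall x : X, gact 1 x = x ;
}.

#[short(type="gspaceType")]
HB.structure Definition GSpace (G : topologicalGroupType) :=
  {X of Topological X & isGSpace G X}.

Definition almost_hausdorff (T : topologicalType) : Prop :=
  forall A : set T, closed A -> A !=set0 ->
    exists U : set T,
      [/\ U !=set0, exists2 O, open O & U = A `&` O
        & hausdorff_space (set_type U)].

Definition locally_closed (T : topologicalType) (A : set T) : Prop :=
  exists C O : set T, [/\ closed C, open O & A = C `&` O].

Definition homeomorphism (S T : topologicalType) (f : S -> T) : Prop :=
  continuous f /\
  exists g : T -> S, [/\ cancel f g, cancel g f & continuous g].

Section orbits.
Context (G : topologicalGroupType) (X : gspaceType G).
Implicit Types (x y z : X) (W A B : set X).

Definition gorbit x : set X := [set gact g x | g in [set: G]].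

Definition orbit_rel x y : bool := `[< gorbit x y >].

Lemma orbit_rel_refl : reflexive orbit_rel.
Proof. by move=> x; apply/asboolP; exists 1 => //; rewrite gact1. Qed.

Lemma orbit_rel_sym : symmetric orbit_rel.
Proof.
suff s x y : orbit_rel x y -> orbit_rel y x by move=> x y; apply/idP/idP; exact: s.
move=> /asboolP[g _ <-]; apply/asboolP; exists (g^-1) => //.
by rewrite gactM mulVg gact1.
Qed.

Lemma orbit_rel_trans : transitive orbit_rel.
Proof.
move=> y x z /asboolP[g _ <-] /asboolP[h _ <-]; apply/asboolP.
by exists (h * g) => //; rewrite gactM.
Qed.

Canonical orbit_equiv :=
  EquivRel orbit_rel orbit_rel_refl orbit_rel_sym orbit_rel_trans.

Definition orbit_space : topologicalType :=
  quotient_topology {eq_quot orbit_equiv}.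

Definition ginvariant A : Prop := forall (g : G) x, A x -> A (gact g x).

Definition girreducible W : Prop :=
  [/\ W !=set0, ginvariant W, closed W &
    forall A B, ginvariant A -> closed A -> ginvariant B -> closed B ->
      W = A `|` B -> A = W \/ B = W].

Definition has_generic_orbit W : Prop := exists x, W = closure (gorbit x).

Definition quasi_regular : Prop :=
  forall W, girreducible W -> has_generic_orbit W.

Definition gstab x : set G := [set g | gact g x = x].

Section cosets.
Context (x : X).

Definition stab_coset_rel (g h : G) : bool := `[< gstab x (g^-1 * h) >].

Lemma stab_coset_relP (g h : G) : reflect (gact g x = gact h x) (stab_coset_rel g h).
Proof.
apply: (iffP (asboolP _)); rewrite /gstab /= => ghx.
  by rewrite -{1}ghx gactM mulgA mulgV mul1g.
by rewrite -gactM -ghx gactM mulVg gact1.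
Qed.

Lemma stab_coset_rel_refl : reflexive stab_coset_rel.
Proof. by move=> g; apply/stab_coset_relP. Qed.

Lemma stab_coset_rel_sym : symmetric stab_coset_rel.
Proof. by move=> g h; apply/stab_coset_relP/stab_coset_relP => ->. Qed.

Lemma stab_coset_rel_trans : transitive stab_coset_rel.
Proof.
by move=> g h k /stab_coset_relP e1 /stab_coset_relP e2;
  apply/stab_coset_relP; rewrite e1.
Qed.

Canonical stab_coset_equiv := EquivRel stab_coset_rel
  stab_coset_rel_refl stab_coset_rel_sym stab_coset_rel_trans.

(* G / G_x, the space of left cosets g G_x *)
Definition stab_quotient : topologicalType :=
  quotient_topology {eq_quot stab_coset_equiv}.

Lemma gorbit_gact (g : G) : gact g x \in gorbit x.
Proof. by apply/mem_set; exists g. Qed.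

(* Independent of the representative, by stab_quotient_to_orbitE *)
Definition stab_quotient_to_orbit (c : stab_quotient) : set_type (gorbit x) :=
  exist _ (gact (repr c) x) (gorbit_gact (repr c)).

Lemma stab_quotient_to_orbitE (g : G) :
  set_val (stab_quotient_to_orbit (\pi_stab_quotient g)) = gact g x.
Proof.
rewrite set_valE /=; apply/stab_coset_relP.
by have /eqquotP := reprK (\pi_stab_quotient g).
Qed.

Definition homogeneous_orbit : Prop := homeomorphism stab_quotient_to_orbit.

End cosets.

Definition regular_gspace : Prop :=
  [/\ quasi_regular, forall x, locally_closed (gorbit x)
    & forall x, homogeneous_orbit x].

End orbits.

Arguments orbit_space {G} X.
Arguments quasi_regular {G} X.
Arguments regular_gspace {G} X.

(* Main.v *)
Require Import Defs.
From HB Require Import structures.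
From mathcomp Require Import all_boot.
From mathcomp Require Import all_classical.
From mathcomp Require Import topology.

(* Let A be closed and invariant and let A `&` O0 be non-empty and Hausdorff.
   Choose a neighbourhood K of 1 and an open P with K P inside O0; by
   compactness G is covered by finitely many translates g_i K.  Shrinking P
   finitely often, A `&` P is either contained in or disjoint from each
   translate g_i O0.  For x in A `&` P and g in g_i K the point g x lies in
   g_i O0, so in the first case it can be separated inside A from any y in
   A `&` P with y != g x because A `&` g_i O0 is Hausdorff, and in the second
   case trivially.  Compactness of G makes this separation uniform in g, hence
   the orbit relation is closed on A `&` P, which yields an open Hausdorff part
   of G \ A.  If A is an orbit closure or is G-irreducible, no two points of
   A `&` P with distinct orbits can be separated in this way, so A `&` P lies in
   a single orbit: orbits are open in their closure, and G-irreducible sets have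
   a generic orbit.
   Uniformity applied to the complement of a set of the form N G_x gives
   openness of g |-> g x. *)

Set Implicit Arguments.
Unset Strict Implicit.
Unset Printing Implicit Defensive.

Local Open Scope classical_set_scope.

(** * Separation in a subspace, finite covers and shrinking of open sets *)

Lemma hausdorff_set_typeP (T : topologicalType) (U : set T) :
  hausdorff_space (set_type U) <->
  forall x y, U x -> U y -> x <> y -> exists S R : set T,
    [/\ open S, open R, S x, R y & forall z, U z -> S z -> ~ R z].
Proof.
rewrite open_hausdorff; split=> [sepU x y Ux Uy xy|sepU [x Ux] [y Uy] xy].
  have xyU : exist _ x (mem_set Ux) != exist _ y (mem_set Uy) :> set_type U.
    by apply/eqP => -[].
  have [[/= S' R'] [/= + + [[S oS SS'] [R oR RR'] /eqP SR]]] := sepU _ _ xyU.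
  rewrite -SS' -RR' !inE /= !set_valE /= => Sx Ry.
  exists S, R; split=> // z Uz Sz Rz.
  suff : set0 (exist _ z (mem_set Uz) : set_type U) by [].
  by rewrite -SR -SS' -RR'; split.
have [|S [R [oS oR Sx Ry SR]]] := sepU x y (set_mem Ux) (set_mem Uy).
  by move=> xyE; move/eqP: xy; apply; exact: val_inj.
exists (set_val @^-1` S, set_val @^-1` R); first by rewrite !inE.
split; [by exists S|by exists R|].
apply/eqP; rewrite -subset0 => -[z Uz] [/= Sz Rz].
by apply: SR Rz => //; exact: set_mem Uz.
Qed.

(** Near-covering compactness for the filter of finite sequences ordered by inclusion: on the
    neighbourhood [U t] of [t], every sequence containing [t] will do. *)
Lemma compact_seq_cover (T : topologicalType) (U : T -> set T) :
  compact [set: T] -> (forall t, nbhs t (U t)) ->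
  exists s : seq T, forall t, exists2 u, u \in s & U u t.
Proof.
move=> /compact_near_coveringP cT nU.
pose F := filter_from [set: seq T]
  (fun s => [set s' : seq T | {subset s <= s'}]).
have FF : Filter F.
  apply: filter_from_filter => [|s r _ _]; first by exists [::].
  exists (s ++ r) => // t st; split=> u us; apply: st;
    by rewrite mem_cat us ?orbT.
have [|s _ /(_ s (fun=> id)) covs] :=
  cT (seq T) F (fun s t => exists2 u, u \in s & U u t) FF.
  move=> t _; exists (U t, [set s | t \in s]).
    split; first exact: nU.
    by exists [:: t] => // s; apply; rewrite inE.
  by move=> [u s] [/= Uu ts]; exists t.
by exists s => t; apply: covs.
Qed.

(** Induction on [s]: intersect [O] with [D i] if the result still meets [A]; otherwise the part of
    [A] in [O] already misses [D i]. Both alternatives survive further shrinking. *)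
Lemma shrink_open (T : topologicalType) (I : eqType) (A P : set T)
    (D : I -> set T) (s : seq I) :
  (forall i, open (D i)) -> open P -> A `&` P !=set0 ->
  exists O, [/\ open O, O `<=` P, A `&` O !=set0
    & forall i, i \in s -> A `&` O `<=` D i \/ A `&` O `<=` ~` D i].
Proof.
move=> oD oP AP; elim: s => [|i s [O [oO OP AO sO]]]; first by exists P; split.
have [AOi|AOi] := pselect (A `&` O `&` D i !=set0).
  exists (O `&` D i); split => //.
  - exact: openI.
  - by move=> x [/OP].
  - by rewrite setIA.
  move=> j; rewrite inE => /predU1P[->|/sO[] AOj].
  - by left => x [_ []].
  - by left => x [Ax [Ox _]]; apply: AOj.
  - by right => x [Ax [Ox _]]; apply: AOj.
exists O; split => // j; rewrite inE => /predU1P[->|/sO//].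
by right => x AOx Dx; apply: AOi; exists x.
Qed.

Local Open Scope group_scope.

(** * Continuity of translations, saturations and invariant sets *)

Lemma gact_near (G : topologicalGroupType) (X : gspaceType G) (g : G) (x : X)
    (S : set X) :
  nbhs (gact g x) S -> \forall h \near g & y \near x, S (gact h y).
Proof. exact: (@gact_continuous G X (g, x)). Qed.

Lemma gact_continuousr (G : topologicalGroupType) (X : gspaceType G) (g : G) :
  continuous (gact g : X -> X).
Proof.
move=> x S /gact_near[[M N] [/= Mg Nx] MN].
by apply: filterS Nx => y Ny; apply: (MN (g, y));
  split=> //=; exact: nbhs_singleton.
Qed.

Lemma gact_continuousl (G : topologicalGroupType) (X : gspaceType G) (x : X) :
  continuous (fun g : G => gact g x).
Proof.
move=> g S /gact_near[[M N] [/= Mg Nx] MN].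
by apply: filterS Mg => h Mh; apply: (MN (h, x));
  split=> //=; exact: nbhs_singleton.
Qed.

Lemma open_gact (G : topologicalGroupType) (X : gspaceType G) (g : G)
    (O : set X) :
  open O -> open (gact g @^-1` O).
Proof. by move=> oO; apply: open_comp => // x _; apply: gact_continuousr. Qed.

Lemma mulg_continuousr (G : topologicalGroupType) (g : G) :
  continuous (fun h : G => g * h).
Proof.
move=> x S /(@mulg_continuous G (g, x))[[M N] [/= Mg Nx] MN].
by apply: filterS Nx => y Ny; apply: (MN (g, y));
  split=> //=; exact: nbhs_singleton.
Qed.

Lemma mulg_continuousl (G : topologicalGroupType) (g : G) :
  continuous (fun h : G => h * g).
Proof.
move=> x S /(@mulg_continuous G (x, g))[[M N] [/= Mx Ng] MN].
by apply: filterS Mx => y My; apply: (MN (y, g));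
  split=> //=; exact: nbhs_singleton.
Qed.

Lemma gactK (G : topologicalGroupType) (X : gspaceType G) (g : G) :
  cancel (gact g : X -> X) (gact g^-1).
Proof. by move=> x; rewrite gactM mulVg gact1. Qed.

Lemma gactKV (G : topologicalGroupType) (X : gspaceType G) (g : G) :
  cancel (gact g^-1 : X -> X) (gact g).
Proof. by move=> x; rewrite gactM mulgV gact1. Qed.

Definition saturation (G : topologicalGroupType) (X : gspaceType G)
  (O : set X) : set X := [set x | exists g, O (gact g x)].

Lemma open_saturation (G : topologicalGroupType) (X : gspaceType G)
    (O : set X) :
  open O -> open (saturation O).
Proof.
move=> oO; have -> : saturation O = \bigcup_(g : G) (gact g @^-1` O).
  by apply/seteqP; split=> x [g]; exists g.
by apply: bigcup_open => g _; exact: open_gact.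
Qed.

Lemma sub_saturation (G : topologicalGroupType) (X : gspaceType G)
    (O : set X) :
  O `<=` saturation O.
Proof. by move=> x Ox; exists 1; rewrite gact1. Qed.

Lemma ginvariant_saturationC (G : topologicalGroupType) (X : gspaceType G)
    (O : set X) :
  ginvariant (~` saturation O).
Proof.
by move=> g x nOx [h]; rewrite gactM => Ohx; apply: nOx; exists (h * g).
Qed.

Lemma ginvariant_gactE (G : topologicalGroupType) (X : gspaceType G)
    (A : set X) (g : G) (x : X) :
  ginvariant A -> A (gact g x) = A x.
Proof.
by move=> gA; apply/propext; split=> [/(gA g^-1)|/(gA g) //]; rewrite gactK.
Qed.

Lemma gorbit_refl (G : topologicalGroupType) (X : gspaceType G) (x : X) :
  gorbit x x.
Proof. by exists 1 => //; rewrite gact1. Qed.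

Lemma ginvariant_gorbit (G : topologicalGroupType) (X : gspaceType G) (x : X) :
  ginvariant (gorbit x).
Proof. by move=> g _ [h _ <-]; exists (g * h) => //; rewrite gactM. Qed.

Lemma ginvariant_closure (G : topologicalGroupType) (X : gspaceType G)
    (A : set X) :
  ginvariant A -> ginvariant (closure A).
Proof.
move=> gA g x clAx S /gact_continuousr /clAx[y [Ay Sy]].
by exists (gact g y); split=> //; apply: gA.
Qed.

(* With D empty, this separates points in distinct orbits by saturated sets. *)
Lemma transporter_upper_semicontinuous (G : topologicalGroupType)
    (X : gspaceType G) (A : set X) :
  compact [set: G] -> almost_hausdorff X ->
  closed A -> ginvariant A -> A !=set0 ->
  exists O : set X, [/\ open O, A `&` O !=set0 &
    forall x y (D : set G), A x -> O x -> A y -> O y -> open D ->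
      (forall g, gact g x = y -> D g) ->
      \forall x' \near x & y' \near y, A x' -> A y' ->
        forall g, gact g x' = y' -> D g].
Proof.
move=> cG ahX cA gA A0.
have [V [[x0 Vx0] [O0 oO0 VE] /hausdorff_set_typeP sepO0]] := ahX A cA A0.
rewrite {V}VE in Vx0 sepO0; have [Ax0 O0x0] := Vx0.
have [[K0 P0] [/= K01 P0x0] KP0] :
    \forall h \near (1 : G) & y \near x0, O0 (gact h y).
  by apply: gact_near; rewrite gact1; exact: open_nbhs_nbhs.
pose K := K0°; pose P := P0°.
have KP h y : K h -> P y -> O0 (gact h y).
  by move=> Kh Py; apply: (KP0 (h, y)); split; exact: interior_subset.
have nK (g h : G) : K (g^-1 * h) -> nbhs h [set h' | K (g^-1 * h')].
  move=> Kgh; apply: mulg_continuousr.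
  by apply: open_nbhs_nbhs; split=> //; exact: open_interior.
have [|s covs] := @compact_seq_cover G (fun g => [set h | K (g^-1 * h)]) cG.
  by move=> g; apply: nK; rewrite mulVg; exact: K01.
have [] := @shrink_open X G A P (fun g => gact g^-1 @^-1` O0) s.
- by move=> g; apply: open_gact.
- exact: open_interior.
- by exists x0.
move=> O [oO OP AO sO]; exists O; split=> // x y D Ax Ox Ay Oy oD xyD.
have /compact_near_coveringP ncG := cG.
(* It suffices to argue near each single [g]: near covering, with the neighbourhood filter of
   [(x, y)] as parameter, yields one neighbourhood valid for all of [G]. *)
suff H (g : G) : [set: G] g -> \forall h \near g & p \near (x, y),
    A p.1 -> A p.2 -> gact h p.1 = p.2 -> D h.
  have Hxy := ncG _ (nbhs (x, y))
    (fun p h => A p.1 -> A p.2 -> gact h p.1 = p.2 -> D h) (nbhs_filter _) H.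
  apply: (@filterS _ (nbhs (x, y)) _ _ _ _ Hxy).
  by move=> p Hp Ap1 Ap2 h; apply: (Hp h).
move=> _; have [Dg|nDg] := pselect (D g).
  exists (D, setT) => /=.
    by split; [exact: open_nbhs_nbhs|exact: filterT].
  by move=> [h p] [].
have gxy : gact g x <> y by move=> /xyD.
(* Here [g] lies in g0 K, so translation by [g0^-1] brings [g x] into [O0]. In the first case it
   brings [y] there too, and the two images are separated inside [A]. *)
have [g0 /sO sg0 Kg] := covs g; have {sg0} [Og0|Og0] := sg0.
  have /= O0g := KP _ _ Kg (OP _ Ox).
  have /= O0y := Og0 _ (conj Ay Oy).
  rewrite -gactM in O0g.
  have [||/(can_inj (@gactKV _ _ g0))//|S [R [oS oR Sx Ry SR]]] :=
    sepO0 (gact g0^-1 (gact g x)) (gact g0^-1 y).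
  - by split=> //; rewrite !ginvariant_gactE.
  - by split=> //; rewrite !ginvariant_gactE.
  have : nbhs (gact g x) (gact g0^-1 @^-1` (S `&` O0)).
    apply: open_nbhs_nbhs; split=> //; apply: open_gact; exact: openI.
  move=> /gact_near[[M N] [/= Mg Nx] MN].
  exists (M, N `*` (gact g0^-1 @^-1` R)).
    split=> //=; exists (N, gact g0^-1 @^-1` R) => //.
    by split=> //=; apply: open_nbhs_nbhs; split=> //; apply: open_gact.
  move=> [h [x' y']] [/= Mh [/= Nx' Ry']] Ax' Ay' hxy.
  have [/= Sh O0h] := MN (h, x') (conj Mh Nx').
  case: (SR (gact g0^-1 y')) => //; last by rewrite -hxy.
  by split; [rewrite ginvariant_gactE|rewrite -hxy].
(* Second case: [h x'] stays in g0 O0, which the points of [A] in [O] avoid, so [h x' = y'] cannot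
   occur. *)
exists ([set h | K (g0^-1 * h)], P `*` O) => /=.
  split; first exact: nK.
  exists (P, O) => //; split; apply: open_nbhs_nbhs; split=> //.
    exact: open_interior.
  exact: OP.
move=> [h [x' y']] [/= Kh [/= Px' Oy']] Ax' Ay' hxy.
by case: (Og0 y') => //=; rewrite -hxy gactM; apply: KP.
Qed.

Local Open Scope quotient_scope.

(** * The orbit space *)

Lemma pi_orbitP (G : topologicalGroupType) (X : gspaceType G) (x y : X) :
  \pi_(orbit_space X) x = \pi_(orbit_space X) y <-> gorbit x y.
Proof.
split=> [/eqmodP/asboolP //|xy].
by apply/eqmodP/asboolP.
Qed.

Lemma open_pi_orbit (G : topologicalGroupType) (X : gspaceType G) (O : set X) :
  open O -> open ([set \pi_(orbit_space X) x | x in O] : set (orbit_space X)).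
Proof.
move=> oO; suff : open (\pi_(orbit_space X) @^-1`
  [set \pi_(orbit_space X) x | x in O]) by [].
rewrite (_ : _ @^-1` _ = saturation O); first exact: open_saturation.
apply/seteqP; split=> x /=.
  by move=> [y Oy /esym/pi_orbitP[g _ gxy]]; exists g; rewrite gxy.
by move=> [g Og]; exists (gact g x) => //; apply/esym/pi_orbitP; exists g.
Qed.

Lemma almost_hausdorff_orbit_space (G : topologicalGroupType)
    (X : gspaceType G) :
  compact [set: G] -> almost_hausdorff X -> almost_hausdorff (orbit_space X).
Proof.
move=> cG ahX B cB [b Bb].
pose p : X -> orbit_space X := \pi_(orbit_space X).
have pK c : p (repr c) = c := reprK c.
have [] := @transporter_upper_semicontinuous G X (p @^-1` B) cG ahX.
- by apply: preimage_closed => // x _; exact: pi_continuous.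
- move=> g x; suff -> : (p @^-1` B) (gact g x) = B (p x) by [].
  by congr B; apply/esym/pi_orbitP; exists g.
- by exists (repr b); rewrite /= pK.
move=> O [oO [x [Bx Ox]] sepO].
exists (B `&` p @` O); split; first by exists (p x); split=> //; exists x.
  by exists (p @` O) => //; exact: open_pi_orbit.
apply/hausdorff_set_typeP => c d [+ [y Oy yc]] [+ [z Oz zd]].
rewrite -{c}yc -{d}zd => By Bz yz.
have [] := sepO y z set0 By Oy Bz Oz open0.
  by move=> g gyz; apply: yz; apply/pi_orbitP; exists g.
move=> [S R] [/= /nbhs_interior nSy /nbhs_interior nRz] SR.
(* The quotient map is open, and a common point of the two images in [B] would give some [g]
   carrying a point of [S] into [R]. *)
exists (p @` S°), (p @` R°); split.
- exact/open_pi_orbit/open_interior.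
- exact/open_pi_orbit/open_interior.
- by exists y => //; exact: nbhs_singleton.
- by exists z => //; exact: nbhs_singleton.
move=> c [Bc _] [s Ss sc] [r Rr]; rewrite -{c}sc in Bc * => rs.
have [g _ gsr] : gorbit s r by apply/pi_orbitP.
apply: (SR (s, r)) gsr => //=.
- by split=> /=; exact: interior_subset.
- by rewrite [p r]rs.
Qed.

(** * Local closedness of orbits and existence of generic orbits *)

Lemma locally_closed_gorbit (G : topologicalGroupType) (X : gspaceType G)
    (x : X) :
  compact [set: G] -> almost_hausdorff X -> locally_closed (gorbit x).
Proof.
move=> cG ahX; have gorb := ginvariant_gorbit (x := x).
have [] := @transporter_upper_semicontinuous G X (closure (gorbit x)) cG ahX.
- exact: closed_closure.
- exact: ginvariant_closure.
- by exists x; apply: subset_closure; exact: gorbit_refl.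
move=> O [oO [y [cly Oy]] sepO].
exists (closure (gorbit x)), (saturation O); split.
- exact: closed_closure.
- exact: open_saturation.
have [_ [[g _ <-] Ogx]] := cly _ (open_nbhs_nbhs (conj oO Oy)).
apply/seteqP; split=> z.
  move=> xz; split; first exact: subset_closure.
  case: xz => h _ <-; exists (g * h^-1).
  by rewrite -gactM gactK.
move=> [clz [h Ohz]]; rewrite -(ginvariant_gactE h) //.
apply: contrapT => nxhz.
have clgx : closure (gorbit x) (gact g x) by apply: subset_closure; exists g.
have clhz : closure (gorbit x) (gact h z).
  by apply: ginvariant_closure.
have [] := sepO _ _ set0 clgx Ogx clhz Ohz open0.
  move=> k kgx; apply: nxhz; exists (k * g) => //.
  by rewrite -gactM.
move=> [S R] [/= Sgx Rhz] SR.
(* [R] is a neighbourhood of a closure point, so it meets the orbit in some [k x]; then [k * g^-1]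
   carries [g x] into [R], against [SR]. *)
have [_ [[k _ <-] Rkx]] := clhz _ Rhz.
apply: (SR (gact g x, gact k x) _ clgx _ (k * g^-1)) => /=.
- by split=> //=; exact: nbhs_singleton.
- by apply: subset_closure; exists k.
- by rewrite -gactM gactK.
Qed.

Lemma quasi_regular_compact (G : topologicalGroupType) (X : gspaceType G) :
  compact [set: G] -> almost_hausdorff X -> quasi_regular X.
Proof.
move=> cG ahX W [W0 gW cW irrW].
have [O [oO [x [Wx Ox]] sepO]] :=
  transporter_upper_semicontinuous cG ahX cW gW W0.
(* Otherwise the complements of the two saturations would cover [W] by proper closed invariant
   subsets, against irreducibility. *)
have dense S R : open S -> open R -> W `&` S !=set0 -> W `&` R !=set0 ->
    exists2 z, W z & saturation S z /\ saturation R z.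
  move=> oS oR [s [Ws Ss]] [r [Wr Rr]]; apply: contrapT => SR.
  have giC Q : ginvariant (W `&` ~` saturation Q).
    by move=> g z [Wz Qz]; split; [exact: gW|exact: ginvariant_saturationC].
  have clC Q : open Q -> closed (W `&` ~` saturation Q).
    by move=> oQ; apply: closedI => //; apply/open_closedC/open_saturation.
  have [|WE|WE] := irrW _ _ (giC S) (clC S oS) (giC R) (clC R oR).
  - apply/seteqP; split=> [z Wz|z [[]|[]] //].
    have [Sz|nSz] := pselect (saturation S z); last by left.
    by right; split=> // Rz; apply: SR; exists z.
  - by move: Ws; rewrite -WE => -[_]; apply; exact: sub_saturation.
  - by move: Wr; rewrite -WE => -[_]; apply; exact: sub_saturation.
(* If the orbits differ, no group element carries a point of [W] near [x] to one near [y], yet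
   [dense] finds an orbit in [W] meeting both neighbourhoods. *)
have Oorb y : W y -> O y -> gorbit x y.
  move=> Wy Oy; apply: contrapT => nxy.
  have [] := sepO _ _ set0 Wx Ox Wy Oy open0.
    by move=> k kxy; apply: nxy; exists k.
  move=> [S R] [/= /nbhs_interior nSx /nbhs_interior nRy] SR.
  have [||||z Wz [[g Sgz] [h Rhz]]] := dense S° R°.
  - exact: open_interior.
  - exact: open_interior.
  - by exists x; split=> //; exact: nbhs_singleton.
  - by exists y; split=> //; exact: nbhs_singleton.
  apply: (SR (gact g z, gact h z) _ _ _ (h * g^-1)) => /=.
  - by split=> /=; exact: interior_subset.
  - exact: gW.
  - exact: gW.
  - by rewrite -gactM gactK.
exists x; apply/seteqP; split=> y.
  move=> Wy S /nbhs_interior nSy.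
  (* The orbit of [z] meets [O], hence is that of [x] by [Oorb], and it also meets [S]. *)
  have [|||z Wz [[g Ogz] [h Shz]]] := dense O S° oO.
  - exact: open_interior.
  - by exists x.
  - by exists y; split=> //; exact: nbhs_singleton.
  exists (gact h z); split; last exact: interior_subset.
  have gorb := ginvariant_gorbit (x := x).
  rewrite ginvariant_gactE // -(ginvariant_gactE g) //; apply: Oorb => //.
  exact: gW.
suff : closure (gorbit x) `<=` closure W.
  by rewrite -((closure_id W).1 cW) => /(_ y).
by apply: closureS => _ [g _ <-]; exact: gW.
Qed.

(** * Openness of the orbit map and homogeneity of orbits *)

Lemma gact_gorbit_open (G : topologicalGroupType) (X : gspaceType G)
    (x : X) (h : G) (N : set G) :
  compact [set: G] -> almost_hausdorff X -> open N -> N h ->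
  \forall y \near gact h x, gorbit x y -> exists2 n, N n & gact n x = y.
Proof.
move=> cG ahX oN Nh.
have [] := @transporter_upper_semicontinuous G X (closure (gorbit x)) cG ahX.
- exact: closed_closure.
- exact/ginvariant_closure/ginvariant_gorbit.
- by exists x; apply: subset_closure; exact: gorbit_refl.
move=> O [oO [y [cly Oy]] sepO].
have [_ [[g _ <-] Ogx]] := cly _ (open_nbhs_nbhs (conj oO Oy)).
have clgx k : closure (gorbit x) (gact k x) by apply: subset_closure; exists k.
(* [sepO] applies only inside [O], so [h x] is moved to [g x] by [g * h^-1]. Accordingly [D] is g
   h^-1 N G_x g^-1, which contains the stabilizer of [g x]. *)
pose D := \bigcup_(s in gstab x) [set c | N (h * g^-1 * c * g * s)].
have := sepO _ _ D (clgx g) Ogx (clgx g) Ogx.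
have oD : open D.
  apply: bigcup_open => s _.
  have -> : [set c | N (h * g^-1 * c * g * s)] =
    (fun c => h * g^-1 * c) @^-1` ((fun c => c * (g * s)) @^-1` N).
    by apply/seteqP; split=> c /=; rewrite mulgA.
  apply: open_comp => [c _|]; first exact: mulg_continuousr.
  by apply: open_comp => // c _; exact: mulg_continuousl.
move=> /(_ oD)[c cgx|[S R] [/= Sgx Rgx] SR].
  exists (g^-1 * c^-1 * g) => /=.
    by rewrite /gstab /= -!gactM -{1}cgx !gactK.
  by rewrite !mulgA !(mulgVK, mulgK).
have : nbhs (gact h x) (gact (g * h^-1) @^-1` R).
  by apply: gact_continuousr; rewrite -gactM gactK.
apply: filterS => z /= Rz [k _ kz]; rewrite -{z}kz in Rz *.
(* The element [g * h^-1 * k * g^-1] carries [g x] into [R], so it lies in [D]; this means that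
   [k * s] is in [N] for some [s] fixing [x]. *)
have [] := SR (gact g x, gact (g * h^-1) (gact k x))
  _ _ _ (g * h^-1 * k * g^-1).
- by split=> //=; exact: nbhs_singleton.
- exact: clgx.
- by rewrite /= gactM.
- by rewrite /= -!gactM gactK.
move=> s xs; rewrite /= => Ns; exists (k * s).
  by move: Ns; rewrite !mulgA !mulgVK mulgV mul1g.
by rewrite -gactM xs.
Qed.

Lemma homogeneous_orbit_compact (G : topologicalGroupType) (X : gspaceType G)
    (x : X) :
  compact [set: G] -> almost_hausdorff X -> homogeneous_orbit x.
Proof.
move=> cG ahX.
pose p : G -> stab_quotient x := \pi_(stab_quotient x).
have pP g h : p g = p h <-> gact g x = gact h x.
  by split=> [/eqmodP/stab_coset_relP //|gh]; apply/eqmodP/stab_coset_relP.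
have toE g : set_val (stab_quotient_to_orbit (p g)) = gact g x.
  exact: stab_quotient_to_orbitE.
have rep (y : set_type (gorbit x)) : exists g, gact g x = set_val y.
  by have [g _ gy] := set_mem (valP y); exists g.
pose f y := projT1 (cid (rep y)).
have fE y : gact (f y) x = set_val y by rewrite /f; case: cid.
split.
  apply/quotient_continuous/continuousP => _ [S oS <-].
  rewrite (_ : _ @^-1` _ = (fun g => gact g x) @^-1` S).
    by apply: open_comp => // g _; exact: gact_continuousl.
  by apply/seteqP; split=> g /=; rewrite toE.
(* [f] is an arbitrary choice, with no continuity claimed; only its class modulo the stabilizer
   matters. *)
exists (p \o f); split=> [c|y|y].
- rewrite -[c in RHS]reprK; apply/pP; rewrite fE.
  by rewrite -[c in LHS]reprK toE.
- by apply: val_inj; rewrite -set_valE; exact: etrans (toE _) (fE _).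
move=> V; rewrite nbhsE => -[Q [oQ Qy] QV].
(* Orbit points near [y] have the form [n x] with [p n] in [Q], and [n] has the same class as the
   representative chosen by [f]. *)
have := @gact_gorbit_open G X x (f y) (p @^-1` Q) cG ahX oQ Qy.
rewrite fE => H.
have : nbhs y (set_val @^-1`
    [set z | gorbit x z -> exists2 n, (p @^-1` Q) n & gact n x = z]).
  exact: initial_continuous H.
apply: filterS => z /= /(_ (set_mem (valP z)))[n Qn nz].
by apply: QV; rewrite (pP _ n).2 // fE nz.
Qed.

Theorem theorem27 (G : topologicalGroupType) (X : gspaceType G)
    (T0G : kolmogorov_space G) (T0X : kolmogorov_space X)
    (compactG : compact [set: G]) (ahX : almost_hausdorff X) :
  almost_hausdorff (orbit_space X) /\ regular_gspace X.
Proof.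
split; first exact: almost_hausdorff_orbit_space.
split=> [|x|x].
- exact: quasi_regular_compact.
- exact: locally_closed_gorbit.
- exact: homogeneous_orbit_compact.
Qed.
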